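(* Let $G$ be a graph with property $( * )$ and $M$ a perfect matching of $G$. Then $\mathrm{mrk}(M)=\mathbf{y}^{\mathrm{ht}(M)}$; in particular all coordinates of $\mathrm{ht}(M)$ are nonnegative. Moreover $D_G(\mathbf y)=\sum_{M}\mathbf{y}^{\mathrm{ht}(M)}$, the sum over all perfect matchings of $G$.
   Context: Property $( * )$: $G$ is a finite connected bipartite plane graph with fixed proper black/white coloring and every edge lies in some perfect matching; $\mathrm{faces}(G)$ is the set of bounded faces. For a bounded face $f$, an edge of $f$ is black-white if going clockwise around $f$ one meets its black endpoint first, white-black otherwise. If a perfect matching contains all black-white edges of $f$, the down-flip at $f$ replaces them by the white-black edges (inverse: up-flip). Perfect matchings with $M\le M'$ iff $M$ is obtained from $M'$ by down-flips form a distributive lattice with minimum $\hat0$. For a saturated chain $\hat0=M_0\lessdot\cdots\lessdot M_\ell=M$ with $M_{i-1},M_i$ related by a flip at face $f_i$, $\mathrm{mrk}(M)=y_{f_1}\cdots y_{f_\ell}$ (this is independent of the chain); $D_G=\sum_M\mathrm{mrk}(M)$. Height: orient the edges of $M\triangle\hat0$ by directing edges of $M\setminus\hat0$ from black to white and edges of $\hat0\setminus M$ from white to black; $M\triangle\hat0$ is a disjoint union of cycles (and isolated vertices), each becoming a clockwise or counterclockwise oriented cycle. $\mathrm{ht}(M)\in\mathbb{Z}^{\mathrm{faces}(G)}$ has $f$-coordinate equal to the number of clockwise cycles encircling $f$ minus the number of counterclockwise cycles encircling $f$ (a cycle encircles $f$ if $f$ lies in its bounded complementary region). $\mathbf{y}^{\mathbf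 a}=\prod_f y_f^{a_f}$. *)

(* Defs.v *)
From Stdlib Require Import ClassicalEpsilon.
From HB Require Import structures.
From mathcomp Require Import all_boot all_order all_algebra.
From mathcomp Require Import fraction mpoly.

Set Implicit Arguments.
Unset Strict Implicit.
Unset Printing Implicit Defensive.

Import Order.TTheory GRing.Theory Num.Theory.

Local Open Scope ring_scope.

(* A finite connected plane graph (parallel edges allowed), given as a
   combinatorial map of genus 0 with a distinguished outer face.  Each edge e
   has two darts (directed edges) (e, true) and (e, false).  [rot] sends a dart
   to the next one counterclockwise around its source, and [rface d] is the face
   on the right of d.  Since [rot (rev d)] is the dart that follows d on the
   boundary walk keeping [rface d] on the right, the darts d with rface d = f
   are those met when going clockwise around a bounded face f.
   [rface_surj] says that every face has a boundary dart, except for the unique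
   face of the one-vertex graph. *)
Record plane_graph := PlaneGraph {
  vertex : finType;
  edge : finType;
  face : finType;
  src : edge * bool -> vertex;
  rot : edge * bool -> edge * bool;
  rface : edge * bool -> face;
  outer : face;
  rot_inj : injective rot;
  src_orbit : forall d d', (src d == src d') = fconnect rot d d';
  rface_orbit : forall d d',
    (rface d == rface d') = fconnect (fun x => rot (x.1, ~~ x.2)) d d';
  rface_surj : forall f g : face, f != g -> exists d, rface d = f;
  connectedG : forall u v : vertex,
    connect (fun a b => [exists d, (src d == a) && (src (d.1, ~~ d.2) == b)]) u v;
  eulerG : (#|vertex| + #|face| = #|edge| + 2)%N }.

Definition dart (G : plane_graph) : finType := (edge G * bool)%type.

Definition rev (G : plane_graph) (d : dart G) : dart G := (d.1, ~~ d.2).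

Definition incident (G : plane_graph) (e : edge G) (v : vertex G) : bool :=
  (src (e, true) == v) || (src (e, false) == v).

Definition perfect_matching (G : plane_graph) (M : {set edge G}) : bool :=
  [forall v : vertex G, #|[set e in M | incident e v]| == 1%N].

Definition proper_coloring (G : plane_graph) (black : pred (vertex G)) : Prop :=
  forall e : edge G, black (src (e, true)) != black (src (e, false)).

(* Finiteness, connectedness and planarity are part of [plane_graph]. *)
Definition property_star (G : plane_graph) (black : pred (vertex G)) : Prop :=
  proper_coloring black /\
  forall e : edge G, exists2 M : {set edge G}, perfect_matching M & e \in M.

(* The set faces(G) of bounded faces. *)
Definition bface (G : plane_graph) : finType := {f : face G | f != outer G}.

Section Matchings.

Variables (G : plane_graph) (black : pred (vertex G)).

Implicit Types (M : {set edge G}) (C : {set edge G}) (f : bface G).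

Definition bw_edges f : {set edge G} :=
  [set d.1 | d : dart G & (rface d == val f) && black (src d)].

Definition wb_edges f : {set edge G} :=
  [set d.1 | d : dart G & (rface d == val f) && ~~ black (src d)].

(* [down_flip f M M'] : M' is the result of the down-flip of M at f. *)
Definition down_flip f M M' : bool :=
  [&& perfect_matching M, bw_edges f \subset M
    & M' == (M :\: bw_edges f) :|: wb_edges f].

Definition pm_le M M' : bool :=
  connect (fun A B => [exists f, down_flip f A B]) M' M.

Definition pm_lt M M' : bool := (M != M') && pm_le M M'.

Definition pm_covers M M' : bool :=
  pm_lt M M' &&
  [forall N : {set edge G}, perfect_matching N ==> ~~ (pm_lt M N && pm_lt N M')].

Definition is_pm_min M : bool :=
  perfect_matching M &&
  [forall N : {set edge G}, perfect_matching N ==> pm_le M N].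

Definition hat0 : {set edge G} := odflt set0 [pick M | is_pm_min M].

(* [sat_chain M0 [:: (f_1, M_1); ...; (f_l, M_l)] M] : M0 < M_1 < ... < M_l = M
   is a saturated chain whose i-th covering is a flip at f_i. *)
Fixpoint sat_chain M0 (c : seq (bface G * {set edge G})) M : bool :=
  if c is (f, M1) :: c' then
    [&& pm_covers M0 M1, down_flip f M1 M0 & sat_chain M1 c' M]
  else M0 == M.

Definition yvar f : {mpoly int[#|bface G|]} := 'X_(enum_rank f).

Definition is_mrk M (p : {mpoly int[#|bface G|]}) : Prop :=
  (exists c, sat_chain hat0 c M) /\
  forall c, sat_chain hat0 c M -> p = \prod_(s <- c) yvar s.1.

(* The common value of the products of face variables along all saturated
   chains from hat0 to M; it is pinned down only if such a chain exists and the
   product does not depend on the chain. *)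
Definition mrk M : {mpoly int[#|bface G|]} := epsilon (inhabits 0) (is_mrk M).

Definition face_poly : {mpoly int[#|bface G|]} :=
  \sum_(M : {set edge G} | perfect_matching M) mrk M.

Definition sym_diff M : {set edge G} := (M :\: hat0) :|: (hat0 :\: M).

Definition oriented M : {set dart G} :=
  [set d : dart G | (d.1 \in M :\: hat0) && black (src d)
                 || (d.1 \in hat0 :\: M) && ~~ black (src d)].

(* The cycles of the symmetric difference, as edge sets: its connected
   components other than isolated vertices. *)
Definition sd_cycles M : {set {set edge G}} :=
  [set [set e' | connect
          (fun a b : edge G => [&& a \in sym_diff M, b \in sym_diff M &
             [exists v, incident a v && incident b v]]) e e']
  | e in sym_diff M].

(* The complementary region of a cycle C containing a face consists of the faces
   reachable from it by crossing edges not in C (and the edges and vertices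
   between them); the bounded region is the one without the outer face. *)
Definition encircles C (g : face G) : bool :=
  ~~ connect (fun a b : face G =>
        [exists d : dart G, [&& d.1 \notin C, rface d == a & rface (rev d) == b]])
      g (outer G).

(* A directed cycle is clockwise when its bounded region lies on its right,
   counterclockwise when it lies on its left. *)
Definition clockwise M C : bool :=
  [forall d in oriented M, (d.1 \in C) ==> encircles C (rface d)].

Definition counterclockwise M C : bool :=
  [forall d in oriented M, (d.1 \in C) ==> encircles C (rface (rev d))].

Definition ht M : {ffun bface G -> int} :=
  [ffun f : bface G =>
     #|[set C in sd_cycles M | clockwise M C && encircles C (val f)]|%:Z
   - #|[set C in sd_cycles M | counterclockwise M C && encircles C (val f)]|%:Z].

End Matchings.

(* A Laurent monomial in the face variables; exponents may be negative, so it
   lives in the field of rational functions. *)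
Definition ymon (G : plane_graph) (a : {ffun bface G -> int}) :
    {fraction {mpoly int[#|bface G|]}} :=
  \prod_(f : bface G) (tofrac (yvar f)) ^ (a f).

(* Main.v *)
(* For perfect matchings M and N, weight each edge of M by +1 from black to white
   and each edge of N by -1.  The result is a flow, and on a plane graph every
   flow is the coboundary of a unique face function vanishing on the outer face,
   the height of M relative to N.  A down-flip at f lowers the height by the
   indicator of f.  If M has positive height somewhere relative to N, then M has
   a down-flip at a face of positive height; hence a matching without down-flips
   is the minimum, and the product along any saturated chain is read off the
   height.  Restricting the flow to one cycle of the symmetric difference with the
   minimum gives plus or minus the indicator of the region that the cycle
   encircles, so the height is [ht]. *)

From Stdlib Require Import ClassicalEpsilon.
From mathcomp Require Import all_boot all_order all_algebra.
From mathcomp Require Import fraction mpoly zify ring.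
Require Import Defs.

Set Implicit Arguments.
Unset Strict Implicit.
Unset Printing Implicit Defensive.

Import Order.TTheory GRing.Theory Num.Theory.

Local Open Scope ring_scope.

Lemma connect_invariant (T : finType) (e : rel T) (Q : T -> Prop) (x y : T) :
  (forall a b, e a b -> Q a -> Q b) -> connect e x y -> Q x -> Q y.
Proof.
move=> Qe /connectP[p]; elim: p x => [|z p IHp] x /= => [_ -> //|].
by case/andP=> exz pz yE Qx; apply: IHp pz yE _; apply: Qe exz Qx.
Qed.

(** * Rank of the signed incidence matrix of a connected multigraph *)

Section DifferenceMatrix.

Variables (I T : finType) (p q : I -> T).

(** The signed incidence matrix of the multigraph on [T] in which [i] joins [q i] to [p i]. It
    serves both for the plane graph and for its dual. *)
Definition diff_mx : 'M[rat]_(#|T|, #|I|) :=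
  \matrix_(i, j) ((p (enum_val j) == enum_val i)%:R
                  - (q (enum_val j) == enum_val i)%:R).

Lemma mul_diff_mx (u : 'rV[rat]_#|T|) j :
  (u *m diff_mx) 0 j
  = u 0 (enum_rank (p (enum_val j))) - u 0 (enum_rank (q (enum_val j))).
Proof.
have pick x : \sum_i u 0 i * (x == enum_val i)%:R = u 0 (enum_rank x).
  rewrite (bigD1 (enum_rank x)) //= enum_rankK eqxx mulr1 big1 ?addr0 // => i.
  by rewrite -(inj_eq enum_val_inj) enum_rankK eq_sym => /negPf->; rewrite mulr0.
rewrite mxE -!pick -sumrB; apply: eq_bigr => i _.
by rewrite mxE mulrBr.
Qed.

(** The left kernel consists of the functions that agree at the two ends of every edge. These are
    constant, so the kernel has dimension at most 1. *)
Lemma rank_diff_mx :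
  (forall u : T -> rat, (forall i, u (p i) = u (q i)) ->
     forall x y, u x = u y) ->
  (#|T| <= (\rank diff_mx).+1)%N.
Proof.
move=> const; rewrite -addn1 -leq_subLR -mxrank_ker.
apply: leq_trans (rank_leq_row (const_mx 1 : 'rV[rat]_#|T|)).
apply: mxrankS; apply/rV_subP=> v /sub_kermxP v0.
have vE i j : v 0 i = v 0 j.
  rewrite -[i]enum_valK -[j]enum_valK.
  apply: (const (fun x => v 0 (enum_rank x))) => k.
  move/matrixP/(_ 0 (enum_rank k)): v0; rewrite mul_diff_mx mxE enum_rankK.
  by move/eqP; rewrite subr_eq0 => /eqP.
(* A constant row is a multiple of the all-ones row, the factor being any entry; if [T] is empty
   there is no entry and [v] is zero. *)
have [i _|noT] := pickP 'I_#|T|.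
  apply/submxP; exists (v 0 i)%:M; apply/rowP=> j.
  by rewrite mul_scalar_mx !mxE mulr1.
have -> : v = 0 by apply/rowP=> j; have := noT j.
exact: sub0mx.
Qed.

End DifferenceMatrix.

(** * Flows and potentials on a plane graph *)

Section PlaneGraph.

Variable G : plane_graph.

Implicit Types (d : dart G) (v : vertex G) (g : face G).

Lemma revK : involutive (@rev G).
Proof. by case=> e b; rewrite /rev /= negbK. Qed.

Lemma rface_rot d : rface (rot d) = rface (rev d).
Proof.
apply/eqP; rewrite eq_sym rface_orbit.
have -> : rot d = rot ((rev d).1, ~~ (rev d).2) by rewrite -[in LHS](revK d).
exact: fconnect1.
Qed.

Lemma src_rot d : src (rot d) = src d.
Proof. by apply/eqP; rewrite eq_sym src_orbit fconnect1. Qed.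

Lemma vertex_invariant (Q : vertex G -> Prop) u v :
  (forall d, Q (src d) -> Q (src (rev d))) -> Q u -> Q v.
Proof.
move=> Qrev; apply: connect_invariant (connectedG u v) => a b.
by case/existsP=> d /andP[/eqP<- /eqP<-]; apply: Qrev.
Qed.

(** [rot] and [rev] together act transitively on darts: [rot] sweeps the darts at one vertex, and
    [rev] moves to a neighbouring vertex. *)
Lemma dart_invariant (P : dart G -> Prop) d d' :
  (forall x, P x -> P (rot x)) -> (forall x, P x -> P (rev x)) ->
  P d -> P d'.
Proof.
move=> Prot Prev Pd.
have Pat x y : src x = src y -> P x -> P y.
  by move/eqP; rewrite src_orbit; apply: connect_invariant => a _ /eqP<-; apply: Prot.
suff: forall x, src x = src d' -> P x by apply.
apply: (@vertex_invariant (fun v => forall x, src x = v -> P x) (src d)).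
  by move=> x Px y yx; apply: (Pat (rev x)); [rewrite yx | apply/Prev/Px].
by move=> x xd; apply: Pat Pd.
Qed.

(** Connectedness of the dual graph, deduced from transitivity on darts. *)
Lemma face_invariant (Q : face G -> Prop) g g' :
  (forall d, Q (rface d) -> Q (rface (rev d))) -> Q g -> Q g'.
Proof.
move=> Qrev Qg; have [<- //|gg'] := eqVneq g g'.
have [d dE] := rface_surj gg'; rewrite eq_sym in gg'.
have [d' d'E] := rface_surj gg'; rewrite -d'E.
apply: (@dart_invariant (fun x => Q (rface x)) d) => //; last by rewrite dE.
by move=> x Qx; rewrite rface_rot; apply: Qrev.
Qed.

Lemma potential_unique (U : zmodType) (h k : face G -> U) :
  (forall d, h (rface d) - h (rface (rev d)) = k (rface d) - k (rface (rev d))) ->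
  h (outer G) = k (outer G) -> h =1 k.
Proof.
move=> hk hk0 g; apply: (@face_invariant (fun g => h g = k g) (outer G)) => // d hkd.
by have := hk d; rewrite hkd => /addrI/oppr_inj.
Qed.

(** The left face of a dart is the right face of the next dart around the vertex, so the sum
    telescopes cyclically. *)
Lemma sum_coboundary (U : zmodType) (h : face G -> U) v :
  \sum_(d : dart G | src d == v) (h (rface d) - h (rface (rev d))) = 0.
Proof.
rewrite sumrB [X in X - _](reindex_inj (@rot_inj G)) /=.
apply/eqP; rewrite subr_eq0; apply/eqP.
by apply: eq_big => [d|d _]; rewrite ?src_rot ?rface_rot.
Qed.

Lemma sum_dartsE (w : dart G -> rat) v :
  (forall d, w (rev d) = - w d) ->
  \sum_(d | src d == v) w d
  = \sum_(e : edge G)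
      w (e, true) * ((src (e, true) == v)%:R - (src (e, false) == v)%:R).
Proof.
move=> wN; rewrite big_mkcond /=.
rewrite (eq_bigr (fun d => (fun e b => if src (e, b) == v then w (e, b) else 0) d.1 d.2));
  last by case.
rewrite -(pair_bigA _ (fun e b => if src (e, b) == v then w (e, b) else 0)) /=.
apply: eq_bigr => e _; rewrite big_bool /=.
have -> : w (e, false) = - w (e, true) by rewrite -wN.
by do 2![case: eqP => _]; rewrite /=; ring.
Qed.

Definition flow (w : dart G -> int) : Prop :=
  (forall d, w (rev d) = - w d) /\ forall v, \sum_(d | src d == v) w d = 0.

Definition potential_of (w : dart G -> int) (h : face G -> int) : Prop :=
  h (outer G) = 0 /\ forall d, w d = h (rface d) - h (rface (rev d)).

(* Genus 0 makes the coboundaries of face functions, of dimension #|F| - 1,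
   exhaust the space of flows, of dimension #|E| - #|V| + 1. *)
Lemma flow_coboundary (w : dart G -> int) :
  flow w -> exists u : face G -> rat,
    forall d, (w d)%:~R = u (rface d) - u (rface (rev d)).
Proof.
move=> [wN w0].
pose D := diff_mx (fun e : edge G => rface (e, true)) (fun e => rface (e, false)).
pose B := diff_mx (fun e : edge G => src (e, true)) (fun e => src (e, false)).
(* For an antisymmetric function on darts, zero net flow at every vertex puts its row of edge values
   in the left kernel of [B^T]. *)
have divE (x : dart G -> rat) : (forall d, x (rev d) = - x d) ->
    (forall v, \sum_(d | src d == v) x d = 0) ->
    (\row_j x (enum_val j, true) : 'rV_#|edge G|) *m B^T = 0.
  move=> xN x0; apply/rowP=> k; rewrite !mxE -[RHS](x0 (enum_val k)) sum_dartsE //.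
  rewrite (reindex (@enum_val (edge G) (edge G))) /=; last first.
    by exists enum_rank => i _; rewrite ?enum_valK ?enum_rankK.
  by apply: eq_bigr => j _; rewrite !mxE.
have rD : (#|face G| <= (\rank D).+1)%N.
  apply: rank_diff_mx => u uE x y.
  apply: (@face_invariant (fun g => u g = u y) y) => // -[e []] <-; rewrite /rev /=;
    by rewrite uE.
have rB : (#|vertex G| <= (\rank B).+1)%N.
  apply: rank_diff_mx => u uE x y.
  apply: (@vertex_invariant (fun a => u a = u y) y x) => // -[e []] <-; rewrite /rev /=;
    by rewrite uE.
have DB : (D <= kermx B^T)%MS.
  apply/rV_subP=> _ /submxP[u ->]; apply/sub_kermxP.
  pose h g := u 0 (enum_rank g).
  rewrite -[RHS](divE (fun d => h (rface d) - h (rface (rev d)))).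
  - congr (_ *m _); apply/rowP=> j; rewrite mul_diff_mx mxE //.
  - by move=> d; rewrite revK opprB.
  - by move=> v; apply: sum_coboundary.
have kerB : (kermx B^T <= D)%MS.
  rewrite -(mxrank_leqif_sup DB) eqn_leq mxrankS //= mxrank_ker mxrank_tr.
  have arith (V F E b c : nat) :
      (V + F = E + 2)%N -> (F <= c.+1)%N -> (V <= b.+1)%N -> (E - b <= c)%N by lia.
  exact: arith (eulerG G) rD rB.
have /submxP[u uE] : ((\row_j (w (enum_val j, true))%:~R : 'rV[rat]_#|edge G|) <= D)%MS.
  apply: submx_trans kerB; apply/sub_kermxP.
  rewrite (divE (fun d => (w d)%:~R)) // => [d|v]; first by rewrite wN rmorphN.
  by rewrite -rmorph_sum w0.
exists (fun g => u 0 (enum_rank g)).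
have wE e : (w (e, true))%:~R = u 0 (enum_rank (rface (e, true)))
                                - u 0 (enum_rank (rface (e, false))).
  by have /rowP/(_ (enum_rank e)) := uE; rewrite mul_diff_mx mxE !enum_rankK.
case=> e [] //; rewrite -[X in w X]revK wN rmorphN /= wE opprB //.
Qed.

(** Once normalized to vanish on the outer face, the rational potential changes by integers across
    edges, so it is integral by connectedness of the dual; [Num.floor] then only changes the
    type. *)
Lemma flow_potential (w : dart G -> int) : flow w -> exists h, potential_of w h.
Proof.
case/flow_coboundary=> u uE.
pose h g := u g - u (outer G).
have hz g : exists z : int, h g = z%:~R.
  apply: (@face_invariant (fun g => exists z : int, h g = z%:~R) (outer G)).
    move=> d [z zE]; exists (z - w d); rewrite rmorphB /= -zE uE /h; ring.
  by exists 0; rewrite /h subrr.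
have hK g : (Num.floor (h g))%:~R = h g.
  by have [z ->] := hz g; rewrite intrKfloor.
exists (fun g => Num.floor (h g)); split=> [|d].
  by rewrite /h subrr floor0.
by apply: (@intr_inj rat); rewrite rmorphB /= !hK uE /h; ring.
Qed.

(* Junk unless [w] is a flow. *)
Definition potential (w : dart G -> int) : face G -> int :=
  epsilon (inhabits (fun=> 0)) (potential_of w).

Lemma potentialP (w : dart G -> int) : flow w -> potential_of w (potential w).
Proof. by move/flow_potential; apply: epsilon_spec. Qed.

End PlaneGraph.

(** * Heights of perfect matchings *)

Section Heights.

Variables (G : plane_graph) (black : pred (vertex G)).
Hypothesis star : property_star black.

Implicit Types (M N X Y : {set edge G}) (d : dart G) (v : vertex G) (g : face G).
Implicit Types (f : bface G).

Definition weight M d : int :=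
  if d.1 \in M then (if black (src d) then 1 else -1) else 0.

Lemma black_rev d : black (src (rev d)) = ~~ black (src d).
Proof.
have [col _] := star; case: d => e b; have := col e.
by rewrite /rev /=; case: b; do 2![case: (black _)].
Qed.

Lemma weight_rev M d : weight M (rev d) = - weight M d.
Proof. by rewrite /weight black_rev /=; case: (_ \in M) => //; case: (black _). Qed.

Lemma src_rev_neq d : src (rev d) != src d.
Proof. by apply/eqP=> sd; have := black_rev d; rewrite sd; case: (black _). Qed.

Lemma dart_edge_eq d d' : d.1 = d'.1 -> d' = d \/ d' = rev d.
Proof.
by case: d d' => e [] [e' []] /= ->; rewrite /rev /=; [left | right | right | left].
Qed.

Lemma sum_weight M v :
  \sum_(d : dart G | src d == v) weight M d
  = (if black v then 1 else -1) * #|[set e in M | incident e v]|%:Z.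
Proof.
rewrite (eq_bigr (fun d => (if black v then 1 else -1) * (d.1 \in M)%:Z)); last first.
  by move=> d /eqP<-; rewrite /weight; case: (_ \in M); rewrite ?mulr1 ?mulr0.
rewrite -mulr_sumr; congr (_ * _).
rewrite -sum1_card big_mkcond /=.
rewrite (eq_bigr (fun d => (fun e b => if src (e, b) == v then (e \in M)%:Z else 0) d.1 d.2));
  last by case.
rewrite -(pair_bigA _ (fun e b => if src (e, b) == v then (e \in M)%:Z else 0)) /=.
rewrite -[RHS]natz natr_sum [RHS]big_mkcond /=.
apply: eq_bigr => e _; rewrite big_bool /= inE /incident.
have := src_rev_neq (e, true); rewrite /rev /=.
have [<- /negPf->|_ _] := eqVneq (src (e, true)) v; first by case: (e \in M).
by case: (e \in M); case: (_ == v).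
Qed.

(** All darts leaving a vertex carry the same sign, so the net weight there counts matched edges.
    Being a perfect matching thus becomes a prescribed divergence, which adding a coboundary
    preserves. *)
Lemma perfect_matchingP M :
  reflect (forall v, \sum_(d : dart G | src d == v) weight M d = if black v then 1 else -1)
          (perfect_matching M).
Proof.
apply: (iffP forallP) => pm v; last first.
  by have := pm v; rewrite sum_weight; case: (black v); lia.
by rewrite sum_weight (eqP (pm v)) mulr1.
Qed.

(** The two darts lie on the same matched edge, and a properly colored graph has no loops. *)
Lemma pm_dart_unique M d d' :
  perfect_matching M -> d.1 \in M -> d'.1 \in M -> src d = src d' -> d = d'.
Proof.
move=> /forallP/(_ (src d))/cards1P[e eE] dM d'M dd'.
have inc x : x.1 \in M -> src x = src d -> x.1 = e.
  move=> xM xd; apply/set1P; rewrite -eE inE xM /incident -xd.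
  by case: x {xM xd} => a []; rewrite eqxx ?orbT.
have : d.1 = d'.1 by exact: etrans (inc d dM erefl) (esym (inc d' d'M (esym dd'))).
case/dart_edge_eq=> [->|d'E]; first by [].

by have := src_rev_neq d; rewrite -d'E dd' eqxx.
Qed.

Lemma weight_diff_flow M N :
  perfect_matching M -> perfect_matching N ->
  flow (fun d => weight M d - weight N d).
Proof.
move=> /perfect_matchingP pM /perfect_matchingP pN; split=> [d|v].
  by rewrite !weight_rev; ring.
by rewrite sumrB pM pN subrr.
Qed.

Definition height M N : face G -> int :=
  potential (fun d => weight M d - weight N d).

Lemma heightE M N d : perfect_matching M -> perfect_matching N ->
  weight M d - weight N d = height M N (rface d) - height M N (rface (rev d)).
Proof. by move=> pM pN; have [_] := potentialP (weight_diff_flow pM pN). Qed.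

Lemma height_outer M N : perfect_matching M -> perfect_matching N ->
  height M N (outer G) = 0.
Proof. by move=> pM pN; have [] := potentialP (weight_diff_flow pM pN). Qed.

Lemma height_unique M N (h : face G -> int) :
  perfect_matching M -> perfect_matching N ->
  potential_of (fun d => weight M d - weight N d) h -> height M N =1 h.
Proof.
move=> pM pN [h0 hE]; apply: potential_unique => [d|].
  by rewrite -hE -heightE.
by rewrite height_outer.
Qed.

Lemma height_sym M N g : perfect_matching M -> perfect_matching N ->
  height M N g = - height N M g.
Proof.
move=> pM pN; apply: (height_unique (h := fun g => - height N M g)) => //.
split=> [|d].
  by rewrite height_outer ?oppr0.
by have := heightE d pN pM; lia.
Qed.

Lemma weight_inj M N : weight M =1 weight N -> M = N.
Proof.
move=> MN; apply/setP=> e; have := MN (e, true); rewrite /weight /=.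
by do 2![case: (e \in _)] => //; case: (black _).
Qed.

Lemma height_inj M N : perfect_matching M -> perfect_matching N ->
  (forall g, height M N g = 0) -> M = N.
Proof.
move=> pM pN h0; apply: weight_inj => d; apply/eqP; rewrite -subr_eq0.
by rewrite heightE // !h0.
Qed.

(* An edge with the same face on both sides has constant weight, so it lies in
   every perfect matching; its ends then have degree 1 and the graph is a single
   edge, which has no bounded face. *)
Lemma bounded_face_no_bridge f d : rface d = val f -> rface (rev d) != val f.
Proof.
move=> df; apply/eqP=> rdf; have [_ cover] := star.
have inall M : perfect_matching M -> d.1 \in M.
  have [N pN dN] := cover d.1; move=> pM.
  have := heightE d pM pN; rewrite df rdf subrr /weight dN.
  by case: ifP => // _; case: (black _).
have deg1 x y : x.1 = d.1 -> src y = src x -> y = x.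
  move=> xd yx; have [M pM yM] := cover y.1.
  by apply: (pm_dart_unique pM) => //; rewrite xd inall.
have [x xo] : exists x : dart G, rface x = outer G.
  by apply: (@rface_surj G _ (val f)); rewrite eq_sym (valP f).
have : x.1 = d.1.
  apply: (@dart_invariant G (fun y => y.1 = d.1) d x) => // y yd.
  by rewrite (deg1 y (rot y)) ?src_rot.
have /eqP fo := valP f; move/esym/dart_edge_eq=> xd; case: fo; move: xo.
by case: xd => ->; rewrite ?df ?rdf.
Qed.

(** * Down-flips and their effect on weights and heights *)

Lemma bw_edgesE f d : black (src d) -> (d.1 \in bw_edges black f) = (rface d == val f).
Proof.
move=> bd; apply/imsetP/idP => [[x]|df]; last by exists d; rewrite ?inE ?df.
rewrite inE => /andP[xf bx] /esym/dart_edge_eq[-> //|dE].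
by move: bd; rewrite dE black_rev bx.
Qed.

Lemma wb_edgesE f d :
  black (src d) -> (d.1 \in wb_edges black f) = (rface (rev d) == val f).
Proof.
move=> bd; apply/imsetP/idP => [[x]|df]; last first.
  by exists (rev d); rewrite ?inE ?df // black_rev bd.
rewrite inE => /andP[xf bx] /esym/dart_edge_eq[dE|->]; last by rewrite revK.
by rewrite -dE bd in bx.
Qed.

(* The edge before [rev d] on the boundary of [f] is black-white, hence matched. *)
Lemma flippable_wb_unmatched M f d :
  perfect_matching M -> bw_edges black f \subset M ->
  black (src d) -> rface (rev d) = val f -> d.1 \notin M.
Proof.
move=> pM bwM bd rdf; apply/negP=> dM.
pose y := finv (@rot G) (rev d).
have yE : rot y = rev d by apply: f_finv; apply: rot_inj.
have ysrc : src y = src (rev d) by rewrite -yE src_rot.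
have ryf : rface (rev y) = val f by rewrite -rface_rot yE.
have yM : y.1 \in M.
  apply: (subsetP bwM); rewrite (bw_edgesE f (d := rev y)) ?ryf //.
  by rewrite black_rev ysrc black_rev bd.
have yd : y = rev d by apply: (pm_dart_unique pM).
by have := bounded_face_no_bridge ryf; rewrite revK yd rdf eqxx.
Qed.

(** A down-flip at [f] subtracts the coboundary of the indicator of [f]. *)
Lemma weight_flip M f d :
  perfect_matching M -> bw_edges black f \subset M ->
  weight ((M :\: bw_edges black f) :|: wb_edges black f) d
  = weight M d - ((rface d == val f)%:Z - (rface (rev d) == val f)%:Z).
Proof.
(* Both sides change sign under [rev], so it suffices to treat darts leaving black vertices. *)
move=> pM bwM; wlog bd : d / black (src d) => [IH|].
  have [/IH //|wd] := boolP (black (src d)).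
  have := IH (rev d); rewrite black_rev wd => /(_ isT).
  by rewrite !weight_rev revK; lia.
rewrite /weight bd inE in_setD bw_edgesE // wb_edgesE //.
(* Having [f] on one side only, an edge cannot be both black-white and white-black for [f]. *)
have [df|_] := eqVneq (rface d) (val f).
  have := bounded_face_no_bridge df => /negPf->.
  have -> : d.1 \in M by apply: (subsetP bwM); rewrite bw_edgesE ?df.
  by [].
have [rdf|_] := eqVneq (rface (rev d)) (val f); last by rewrite orbF subrr subr0.
by rewrite (negPf (flippable_wb_unmatched pM bwM bd rdf)).
Qed.

Lemma flip_perfect M f :
  perfect_matching M -> bw_edges black f \subset M ->
  perfect_matching ((M :\: bw_edges black f) :|: wb_edges black f).
Proof.
move=> pM bwM; apply/perfect_matchingP=> v.
rewrite (eq_bigr _ (fun d _ => weight_flip d pM bwM)) sumrB.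
rewrite (perfect_matchingP M pM) (sum_coboundary (fun g => (g == val f)%:Z)).
by rewrite subr0.
Qed.

Lemma down_flip_perfect f M M' :
  down_flip black f M M' -> perfect_matching M /\ perfect_matching M'.
Proof. by case/and3P=> pM bwM /eqP->; split=> //; apply: flip_perfect. Qed.

Lemma down_flip_height f M M' N g : down_flip black f M M' -> perfect_matching N ->
  height M N g = height M' N g + (val f == g)%:Z.
Proof.
move=> fl pN; have [pM pM'] := down_flip_perfect fl.
apply: (height_unique (h := fun g => height M' N g + (val f == g)%:Z)) => //.
split=> [|d].
  by rewrite height_outer // add0r (negPf (valP f)).
have := heightE d pM' pN; case/and3P: fl => _ bwM /eqP->.
rewrite weight_flip // !(eq_sym (val f)); lia.
Qed.

(* Among the faces of maximal height choose one minimizing the sum [K] of the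
   heights of all matchings relative to [M]: crossing an unmatched black-white
   edge of it would keep the height maximal and decrease [K]. *)
Lemma flippable_face M N g :
  perfect_matching M -> perfect_matching N -> 0 < height M N g ->
  exists f, (bw_edges black f \subset M) && (0 < height M N (val f)).
Proof.
move=> pM pN g_gt0; have [_ cover] := star.
pose K x := \sum_(N' : {set edge G} | perfect_matching N') height N' M x.
have [m _ m_max] := arg_maxP (P := predT) (height M N) (erefl (predT g)).
have mmax y : height M N y <= height M N m by exact: m_max.
pose A x := height M N x == height M N m.
have [x /eqP xA xmin] := @arg_minP _ int _ m A K (eqxx _).
have x_gt0 : 0 < height M N x by rewrite xA; apply: lt_le_trans g_gt0 (mmax g).
have x_bounded : x != outer G.
  by apply: contraTneq x_gt0 => ->; rewrite height_outer.
exists (Sub x x_bounded); rewrite SubK x_gt0 andbT.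
apply/subsetP=> _ /imsetP[d + ->]; rewrite inE SubK => /andP[/eqP dx bd].
apply/negPn/negP=> dM.
have dA : A (rface (rev d)).
  (* The weight difference at [d] is 0 or -1, so the height cannot decrease when [d] is crossed from
     right to left. *)
  apply/eqP; apply: le_anti; rewrite mmax //= -xA -dx.
  have := heightE d pM pN; rewrite /weight (negPf dM) bd.
  by case: ifP; lia.
have := xmin _ dA; rewrite -dx leNgt => /negP; apply.
(* The drop of [K] across [d] is the number of perfect matchings containing [d.1]; [property_star]
   supplies one, [N0]. *)
rewrite -subr_gt0 /K -sumrB.
have [N0 pN0 dN0] := cover d.1.
rewrite (eq_bigr (fun N' => (d.1 \in N')%:Z)); last first.
  move=> N' pN'; rewrite -heightE // /weight (negPf dM) bd subr0.
  by case: ifP.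
rewrite (bigD1 N0) //= dN0 ltr_pwDl ?ltr01 //.
exact: sumr_ge0.
Qed.

(** * Total height as a rank function, the minimum matching and saturated chains *)

Definition total_height N M : int := \sum_g height M N g.

Lemma down_flip_total f M M' N : down_flip black f M M' -> perfect_matching N ->
  total_height N M = total_height N M' + 1.
Proof.
move=> fl pN; rewrite /total_height.
rewrite (eq_bigr _ (fun g _ => down_flip_height g fl pN)) big_split /=.
congr (_ + _); rewrite (bigD1 (val f)) //= eqxx big1 ?addr0 // => g.
by rewrite eq_sym => /negPf->.
Qed.

Lemma pm_lt_total M M' N : perfect_matching N ->
  pm_lt black M M' -> total_height N M < total_height N M'.
Proof.
move=> pN /andP[neq MM']; apply/negPn/negP=> nlt; case/eqP: neq.
have [//|lt] : M = M' \/ total_height N M < total_height N M'.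
  apply: (connect_invariant (Q := fun X => X = M' \/ total_height N X < total_height N M'))
    MM' _; last by left.
  move=> X Y /existsP[f fl] XM'; right.
  by have := down_flip_total fl pN; case: XM' => [->|]; lia.
by rewrite lt in nlt.
Qed.

(** The total height is an integer, strictly monotone for the order, and a flip changes it by
    exactly 1, which leaves no room in between. *)
Lemma down_flip_covers f M M' : down_flip black f M M' -> pm_covers black M' M.
Proof.
move=> fl; have [pM pM'] := down_flip_perfect fl.
have tot := down_flip_total fl pM.
apply/andP; split.
  apply/andP; split; first by apply/eqP=> MM'; rewrite MM' in tot; lia.
  by apply/connect1/existsP; exists f.
apply/forallP=> N; apply/implyP=> pN; apply/negP=> /andP[].
by move=> /(pm_lt_total pM) + /(pm_lt_total pM); lia.
Qed.

(** Induction on the total height of [N] relative to [M]. At 0 all heights vanish and the matchings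
    agree; otherwise [flippable_face] gives a flip at a face of positive height, so heights stay
    nonnegative. *)
Lemma pm_le_of_height n M N : perfect_matching M -> perfect_matching N ->
  (forall g, 0 <= height N M g) -> total_height M N = n%:Z -> pm_le black M N.
Proof.
move=> pM; elim: n N => [|n IHn] N pN h_ge0 totN.
  suff -> : N = M by apply: connect0.
  apply: height_inj => // g; apply/eqP; move/eqP: totN.
  by rewrite psumr_eq0 // => /allP/(_ g (mem_index_enum g))/implyP; apply.
have [g g_gt0|h_le0] := pickP (fun g => 0 < height N M g); last first.
  have : total_height M N <= 0 by apply: sumr_le0 => g _; rewrite leNgt h_le0.
  by rewrite totN.
have [f /andP[bwN f_gt0]] := flippable_face pN pM g_gt0.
pose N' := (N :\: bw_edges black f) :|: wb_edges black f.
have fl : down_flip black f N N' by apply/and3P.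
have [_ pN'] := down_flip_perfect fl.
apply: (connect_trans (y := N')); first by apply/connect1/existsP; exists f.
apply: IHn => // [g'|]; last by have := down_flip_total fl pM; lia.
have := down_flip_height g' fl pM; have := h_ge0 g'.
by have [<-|_] := eqVneq (val f) g'; lia.
Qed.

(** A matching [M0] of least total height admits no down-flip. By [flippable_face] it is then
    nowhere higher than any other matching, and [pm_le_of_height] puts it below all of them. *)
Lemma exists_pm_min M : perfect_matching M -> exists N, is_pm_min black N.
Proof.
move=> pM.
have [M0 pM0 M0min] := @arg_minP _ int _ M (@perfect_matching G) (total_height M) pM.
exists M0; apply/andP; split=> //; apply/forallP=> N; apply/implyP=> pN.
have h_ge0 g : 0 <= height N M0 g.
  rewrite height_sym // oppr_ge0 leNgt; apply/negP=> g_gt0.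
  have [f /andP[bwM0 _]] := flippable_face pM0 pN g_gt0.
  have pF := flip_perfect pM0 bwM0.
  have fl : down_flip black f M0 ((M0 :\: bw_edges black f) :|: wb_edges black f).
    by apply/and3P.
  by have := M0min _ pF; have := down_flip_total fl pM; lia.
apply: (@pm_le_of_height (`|total_height M0 N|%N)) => //.
by rewrite gez0_abs //; apply: sumr_ge0.
Qed.

Lemma hat0P M : perfect_matching M -> is_pm_min black (hat0 black).
Proof.
case/exists_pm_min=> N minN; rewrite /hat0.
by case: pickP => [//|/(_ N)]; rewrite minN.
Qed.

(** A sequence of down-flips read backwards is already saturated, each flip being a covering. *)
Lemma sat_chain_exists M M' : pm_le black M' M -> exists c, sat_chain black M' c M.
Proof.
move=> le.
apply: (connect_invariant (Q := fun X => exists c, sat_chain black X c M)) le _ => [X Y|];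
  last first.
  by exists [::]; rewrite /= eqxx.
case/existsP=> f fl [c cX]; exists ((f, X) :: c) => /=.
by rewrite (down_flip_covers fl) fl.
Qed.

(** Hence the number of flips at each bounded face depends only on the ends of the chain. *)
Lemma sat_chain_height M M' N c g : perfect_matching N -> sat_chain black M' c M ->
  height M N g = height M' N g + (\sum_(s <- c) (val s.1 == g))%N%:Z.
Proof.
move=> pN; elim: c M' => [|[f X] c IHc] M' /=.
  by move/eqP->; rewrite big_nil addr0.
case/and3P=> _ fl /IHc->; rewrite big_cons (down_flip_height g fl pN) PoszD /=; ring.
Qed.

End Heights.

(** * The two sides of a cycle of the symmetric difference *)

Section Sides.

Variables (G : plane_graph) (C : {set edge G}).

Implicit Types (d x y z : dart G) (a b g : face G).

(** The relation whose reachability [encircles] negates. *)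
Definition adjacent_off a b : bool :=
  [exists d : dart G, [&& d.1 \notin C, rface d == a & rface (rev d) == b]].

Lemma adjacent_off_sym : connect_sym adjacent_off.
Proof.
apply: sym_connect_sym => a b.
apply/existsP/existsP=> -[d /and3P[dC da db]]; exists (rev d);
  by rewrite revK da db dC.
Qed.

Lemma adjacent_off_rev d :
  d.1 \notin C -> connect adjacent_off (rface d) (rface (rev d)).
Proof. by move=> dC; apply/connect1/existsP; exists d; rewrite dC !eqxx. Qed.

(* Turn around the common source from [z] to [y]; no edge of [C] is crossed on
   the way. *)
Lemma corner_connect y z :
  src y = src z -> y != z ->
  (forall x, src x = src z -> x.1 \in C -> x = y \/ x = z) ->
  connect adjacent_off (rface (rev z)) (rface y).
Proof.
move=> yz neq only.
have turn k : connect adjacent_off (rface (rev z)) (rface y) \/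
    connect adjacent_off (rface (rev z)) (rface (rev (iter k (@rot G) z))).
  elim: k => [|k [IHk|IHk]]; [by right | by left|].
  rewrite iterS; set x := iter k _ z in IHk *.
  have srcx : src (rot x) = src z.
    by rewrite /x src_rot; elim: k {IHk x} => //= k IHk; rewrite src_rot.
  rewrite -(rface_rot x) in IHk.
  have [xC|xC] := boolP ((rot x).1 \in C); last first.
    by right; apply: connect_trans IHk (adjacent_off_rev xC).
  by case: (only _ srcx xC) => <-; [left | right].
have /iter_findex : fconnect (@rot G) z y by rewrite -src_orbit yz.
case: (findex _ z y) => [zy|k yE]; first by rewrite -zy eqxx in neq.
by case: (turn k) => //; rewrite -[rface (rev (iter _ _ _))]rface_rot -iterS yE.
Qed.

End Sides.

(** * The components of the symmetric difference with [hat0] and their potentials *)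

Section Cycles.

Variables (G : plane_graph) (black : pred (vertex G)).
Hypothesis star : property_star black.
Variable M : {set edge G}.
Hypotheses (pM : perfect_matching M) (pH : perfect_matching (hat0 black)).

Implicit Types (d x y z : dart G) (e : edge G) (g : face G) (C : {set edge G}).

Let S := sym_diff black M.

Definition sd_flow d : int := weight black M d - weight black (hat0 black) d.

Definition sd_adjacent : rel (edge G) := fun a b =>
  [&& a \in S, b \in S & [exists v, incident a v && incident b v]].

Definition sd_component e : {set edge G} := [set e' | connect sd_adjacent e e'].

Lemma sd_flow_rev d : sd_flow (rev d) = - sd_flow d.
Proof. by rewrite /sd_flow !(weight_rev star); ring. Qed.

Lemma sd_flowP d :
  [\/ sd_flow d = 1 /\ d.1 \in S, sd_flow d = -1 /\ d.1 \in S
    | sd_flow d = 0 /\ d.1 \notin S].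
Proof.
rewrite /sd_flow /weight /S /sym_diff !inE.
case: (d.1 \in M); case: (d.1 \in hat0 black); case: (black (src d));
  first [by apply: Or31 | by apply: Or32 | by apply: Or33].
Qed.

Lemma orientedE d : (d \in oriented black M) = (sd_flow d == 1).
Proof.
rewrite inE /sd_flow /weight !inE.
by case: (d.1 \in M); case: (d.1 \in hat0 black); case: (black (src d)).
Qed.

(** Flow 1 out of a black vertex uses an edge of [M], and out of a white vertex an edge of [hat0];
    either matching has a single edge there. *)
Lemma sd_flow_out_unique x y :
  sd_flow x = 1 -> sd_flow y = 1 -> src x = src y -> x = y.
Proof.
move=> + + xy; rewrite /sd_flow /weight xy.
case: (boolP (black (src y))) => _.
- have [xM|_] := boolP (x.1 \in M); last by case: ifP.
  have [yM|_] := boolP (y.1 \in M); last by case: (y.1 \in hat0 black).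
  by move=> _ _; apply: (pm_dart_unique star pM).
- have [xH|_] := boolP (x.1 \in hat0 black); last by case: ifP.
  have [yH|_] := boolP (y.1 \in hat0 black); last by case: (y.1 \in M).
  by move=> _ _; apply: (pm_dart_unique star pH).
Qed.

Lemma sd_flow_in_unique x y :
  sd_flow x = -1 -> sd_flow y = -1 -> src x = src y -> x = y.
Proof.
move=> + + xy; rewrite /sd_flow /weight xy.
case: (boolP (black (src y))) => _.
- have [xH|_] := boolP (x.1 \in hat0 black); last by case: ifP.
  have [yH|_] := boolP (y.1 \in hat0 black); last by case: (y.1 \in M).
  by move=> _ _; apply: (pm_dart_unique star pH).
- have [xM|_] := boolP (x.1 \in M); last by case: ifP.
  have [yM|_] := boolP (y.1 \in M); last by case: (y.1 \in hat0 black).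
  by move=> _ _; apply: (pm_dart_unique star pM).
Qed.

Lemma sd_adjacent_sym : connect_sym sd_adjacent.
Proof.
apply: sym_connect_sym => a b; rewrite /sd_adjacent andbCA; congr [&& _, _ & _].
by apply/existsP/existsP=> -[v]; rewrite andbC; exists v.
Qed.

Lemma sd_component_sub e : e \in S -> sd_component e \subset S.
Proof.
move=> eS; apply/subsetP=> e'; rewrite inE => ee'.
apply: (connect_invariant (Q := fun e => is_true (e \in S))) ee' eS => a b.
by case/and3P.
Qed.

Lemma incident_src d : incident d.1 (src d).
Proof. by case: d => e []; rewrite /incident eqxx ?orbT. Qed.

Lemma sd_component_share e x y : e \in S ->
  x.1 \in sd_component e -> y.1 \in S -> src x = src y -> y.1 \in sd_component e.
Proof.
move=> eS xC yS xy; have xS := subsetP (sd_component_sub eS) _ xC.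
move: xC; rewrite !inE => /connect_trans; apply; apply: connect1.
rewrite /sd_adjacent xS yS; apply/existsP; exists (src x).
by rewrite incident_src xy incident_src.
Qed.

Lemma sd_oriented e : e \in S -> exists2 d, d.1 = e & sd_flow d = 1.
Proof.
move=> eS; case: (sd_flowP (e, true)) => -[w1 eS']; last by rewrite eS in eS'.
  by exists (e, true).
by exists (rev (e, true)) => //; rewrite sd_flow_rev w1.
Qed.

Section Component.

Variable e0 : edge G.
Hypothesis e0S : e0 \in S.
Let C := sd_component e0.

Definition component_flow d : int := if d.1 \in C then sd_flow d else 0.

(** At each vertex a component contains either all edges of the symmetric difference or none, so its
    divergence is that of [sd_flow] or an empty sum. *)
Lemma component_flow_flow : flow component_flow.
Proof.
split=> [d|v].
  by rewrite /component_flow /=; case: ifP => // _; rewrite sd_flow_rev.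
have [_ sd0] := weight_diff_flow star pM pH.
have [/existsP[x /andP[/eqP xv xC]]|/existsPn noC] :=
    boolP [exists x : dart G, (src x == v) && (x.1 \in C)].
  rewrite -[RHS](sd0 v); apply: eq_bigr => d /eqP dv; rewrite /component_flow.
  case: ifP => // /negP dC; case: (sd_flowP d) => -[wd dS] //.
  - by case: dC; apply: (sd_component_share e0S xC dS); rewrite xv dv.
  - by case: dC; apply: (sd_component_share e0S xC dS); rewrite xv dv.
rewrite big1 // => d dv; rewrite /component_flow.
by have := noC d; rewrite dv /= => /negPf->.
Qed.

(** At the head of [x] the only darts on [C] are [rev x] and [y]. Turning between them in one sense
    joins the right faces, in the other sense the left faces. *)
Lemma corner_right_left x y :
  sd_flow x = 1 -> sd_flow y = 1 -> src y = src (rev x) ->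
  connect (adjacent_off C) (rface x) (rface y) /\
  connect (adjacent_off C) (rface (rev x)) (rface (rev y)).
Proof.
move=> wx wy yx.
have wrx : sd_flow (rev x) = -1 by rewrite sd_flow_rev wx.
have neq : y != rev x.
  by apply/eqP=> yE; move: wy; rewrite yE wrx.
have only z : src z = src y -> z.1 \in C -> z = y \/ z = rev x.
  move=> zy zC; have zS := subsetP (sd_component_sub e0S) _ zC.
  case: (sd_flowP z) => -[wz zS']; last by rewrite zS in zS'.
  - by left; apply: sd_flow_out_unique.
  - by right; apply: sd_flow_in_unique => //; rewrite zy.
split.
  by rewrite -[x in rface x]revK; apply: corner_connect => // z; rewrite -yx; apply: only.
rewrite adjacent_off_sym; apply: corner_connect; rewrite // 1?eq_sym // => z zy zC.
by case: (only z zy zC); [right | left].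
Qed.

(** [corner_right_left] is propagated along a chain of adjacent edges, so all right faces of the
    component lie in one region, and all left faces in one region. *)
Lemma component_sides x y : x.1 \in C -> y.1 \in C -> sd_flow x = 1 -> sd_flow y = 1 ->
  connect (adjacent_off C) (rface x) (rface y) /\
  connect (adjacent_off C) (rface (rev x)) (rface (rev y)).
Proof.
move=> xC yC wx wy.
have xy : connect sd_adjacent x.1 y.1.
  rewrite !inE in xC yC; apply: connect_trans yC.
  by rewrite sd_adjacent_sym.
pose Q e := forall z, z.1 = e -> sd_flow z = 1 ->
  connect (adjacent_off C) (rface x) (rface z) /\
  connect (adjacent_off C) (rface (rev x)) (rface (rev z)).
suff : Q y.1 by apply.
apply: (connect_invariant (Q := Q)) xy _ => [a b|z zx wz]; last first.
  case/esym/dart_edge_eq: zx => zE; first by rewrite zE !connect0.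
  by move: wz; rewrite zE sd_flow_rev wx.
case/and3P=> aS bS /existsP[v /andP[av bv]] Qa zb zbE wzb.
have [za zaE wza] := sd_oriented aS.
have [Qr Ql] := Qa za zaE wza.
have ends (z : dart G) : incident z.1 v -> src z = v \/ src (rev z) = v.
  by case: z => e []; rewrite /incident /rev /= => /orP[]/eqP ->; auto.
rewrite -zaE in av; rewrite -zbE in bv.
(* Positive darts with a common tail or a common head coincide; in the mixed cases one of them
   leaves the head of the other. *)
case: (ends za av) => sa; case: (ends zb bv) => sb.
- by rewrite -(sd_flow_out_unique wza wzb) // sa sb.
- have [|r l] := corner_right_left wzb wza; first by rewrite sa sb.
  rewrite adjacent_off_sym in r; rewrite adjacent_off_sym in l.
  by split; [apply: connect_trans r | apply: connect_trans l].
- have [|r l] := corner_right_left wza wzb; first by rewrite sa sb.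
  by split; [apply: connect_trans r | apply: connect_trans l].
- have /(congr1 (@rev G)) : rev za = rev zb.
    by apply: sd_flow_in_unique; rewrite ?sd_flow_rev ?wza ?wzb ?sa ?sb.
  by rewrite !revK => <-.
Qed.

(* Every face lies on the right or on the left of the component, and the
   potential drops by 1 from right to left, so it is plus or minus the indicator
   of the side avoiding the outer face. *)
Lemma component_potential g :
  potential component_flow g
  = (clockwise black M C && encircles C g)%:Z
    - (counterclockwise black M C && encircles C g)%:Z.
Proof.
have [h0 hE] := potentialP component_flow_flow.
set h := potential _ in h0 hE *.
have [d0 d0E w0] := sd_oriented e0S.
have d0C : d0.1 \in C by rewrite d0E inE connect0.
have h_const a b : connect (adjacent_off C) a b -> h a = h b.
  move=> ab; apply/esym.
  apply: (connect_invariant (Q := fun b => h b = h a)) ab _ => // x y.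
  case/existsP=> d /and3P[dC /eqP<- /eqP<-] <-.
  by have := hE d; rewrite /component_flow (negPf dC); lia.
have h_drop : h (rface d0) = h (rface (rev d0)) + 1.
  by have := hE d0; rewrite /component_flow d0C w0; lia.
have side a : connect (adjacent_off C) (rface d0) a \/
              connect (adjacent_off C) (rface (rev d0)) a.
  apply: (@face_invariant _ (fun a => connect (adjacent_off C) (rface d0) a \/
              connect (adjacent_off C) (rface (rev d0)) a) (rface d0)); last by left.
  move=> d; have [dC|dC] := boolP (d.1 \in C); last first.
    by case=> ad; [left | right]; apply: connect_trans ad (adjacent_off_rev dC).
  move=> _; have dS := subsetP (sd_component_sub e0S) _ dC.
  case: (sd_flowP d) => -[wd dS']; last by rewrite dS in dS'.
  - by right; case: (component_sides d0C dC w0 wd).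
  - left; have wrd : sd_flow (rev d) = 1 by rewrite sd_flow_rev wd.
    by case: (@component_sides d0 (rev d) d0C dC w0 wrd).
have encE a : encircles C a = ~~ connect (adjacent_off C) a (outer G) by [].
have d0o : d0 \in oriented black M by rewrite orientedE w0.
(* The side of the outer face has potential 0 and the other side 1 or -1. Since the potential is
   constant on regions, the two sides are different regions; this replaces the Jordan curve
   theorem. *)
case: (side (outer G)) => out.
- have h_right : h (rface d0) = 0 by rewrite (h_const _ _ out).
  have encR a : connect (adjacent_off C) (rface d0) a -> encircles C a = false.
    by move=> da; apply/negbTE; rewrite encE negbK -(same_connect (@adjacent_off_sym _ _) da).
  have encL a : connect (adjacent_off C) (rface (rev d0)) a -> encircles C a.
    by move=> da; rewrite encE; apply/negP=> /h_const; rewrite h0 -(h_const _ _ da); lia.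
  have -> : clockwise black M C = false.
    apply/negP=> /forall_inP/(_ _ d0o); rewrite d0C /= encR //; exact: connect0.
  have -> : counterclockwise black M C.
    apply/forall_inP=> d; rewrite orientedE => /eqP wd; apply/implyP=> dC.
    by apply: encL; case: (component_sides d0C dC w0 wd).
  case: (side g) => dg; rewrite -(h_const _ _ dg); first by rewrite encR.
  by rewrite encL //=; lia.
- have h_left : h (rface (rev d0)) = 0 by rewrite (h_const _ _ out).
  have encL a : connect (adjacent_off C) (rface (rev d0)) a -> encircles C a = false.
    by move=> da; apply/negbTE; rewrite encE negbK -(same_connect (@adjacent_off_sym _ _) da).
  have encR a : connect (adjacent_off C) (rface d0) a -> encircles C a.
    by move=> da; rewrite encE; apply/negP=> /h_const; rewrite h0 -(h_const _ _ da); lia.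
  have -> : counterclockwise black M C = false.
    apply/negP=> /forall_inP/(_ _ d0o); rewrite d0C /= encL //; exact: connect0.
  have -> : clockwise black M C.
    apply/forall_inP=> d; rewrite orientedE => /eqP wd; apply/implyP=> dC.
    by apply: encR; case: (component_sides d0C dC w0 wd).
  case: (side g) => dg; rewrite -(h_const _ _ dg); last by rewrite encL.
  by rewrite encR //=; lia.
Qed.

End Component.

Lemma sd_cyclesP C :
  reflect (exists2 e, e \in S & C = sd_component e) (C \in sd_cycles black M).
Proof. exact: imsetP. Qed.

Lemma sd_component_eq e e' : e' \in sd_component e -> sd_component e = sd_component e'.
Proof.
rewrite inE => ee'; apply/setP=> x; rewrite !inE.
exact: same_connect sd_adjacent_sym _ _ ee' x.
Qed.

(** The components partition the symmetric difference, so exactly one term survives wherever the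
    flow is nonzero. *)
Lemma sum_cycles_flow d :
  \sum_(C in sd_cycles black M) (if d.1 \in C then sd_flow d else 0) = sd_flow d.
Proof.
have [dS|dS] := boolP (d.1 \in S); last first.
  case: (sd_flowP d) => -[wd dS']; [by rewrite dS' in dS | by rewrite dS' in dS |].
  by rewrite wd big1 // => C _; case: ifP.
have dC : sd_component d.1 \in sd_cycles black M by apply/sd_cyclesP; exists d.1.
rewrite (bigD1 _ dC) /= inE connect0 big1 ?addr0 // => C /andP[/sd_cyclesP[e eS ->]].
by case: ifP => // /sd_component_eq->; rewrite eqxx.
Qed.

(** Potentials add: the signed indicators of the components sum to a potential of [sd_flow], which
    is unique. *)
Lemma height_ht (f : bface G) : height black M (hat0 black) (val f) = ht black M f.
Proof.
pose h g := \sum_(C in sd_cycles black M)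
  ((clockwise black M C && encircles C g)%:Z
   - (counterclockwise black M C && encircles C g)%:Z).
have cycle_potential C : C \in sd_cycles black M ->
    potential_of (fun d => if d.1 \in C then sd_flow d else 0)
      (fun g => (clockwise black M C && encircles C g)%:Z
                - (counterclockwise black M C && encircles C g)%:Z).
  case/sd_cyclesP=> e eS ->; have [h0 hE] := potentialP (component_flow_flow eS).
  by split=> [|d]; rewrite -!(component_potential eS) ?h0 -?hE.
have -> : height black M (hat0 black) (val f) = h (val f).
  apply: height_unique => //; split=> [|d].
    by rewrite /h big1 // => C /cycle_potential[].
  rewrite -/(sd_flow d) -sum_cycles_flow /h -sumrB.
  by apply: eq_bigr => C /cycle_potential[_].
rewrite /h sumrB ffunE.
have cardE (P : pred {set edge G}) :
    \sum_(C in sd_cycles black M) (P C)%:Z = #|[set C in sd_cycles black M | P C]|%:Z.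
  rewrite -sum1_card -[RHS]natz natr_sum [RHS](eq_bigl _ _ (fun C => in_set _ C)).
  rewrite big_mkcondr /=; apply: eq_bigr => C _.
  by case: (P C).
by rewrite !cardE.
Qed.

End Cycles.

(** * Face monomials along saturated chains, and the conclusion *)

Lemma prod_expr_count (R : comUnitRingType) (I : finType) (T : Type) (Y : I -> R)
    (c : seq (I * T)) :
  \prod_(i : I) Y i ^ (\sum_(s <- c) (s.1 == i))%N%:Z = \prod_(s <- c) Y s.1.
Proof.
under eq_bigr do rewrite -exprnP -prodrXr.
rewrite exchange_big /=; apply: eq_bigr => s _.
rewrite (bigD1 s.1) //= eqxx big1 ?mulr1 // => i.
by rewrite eq_sym => /negPf->.
Qed.

Theorem theorem2p16 (G : plane_graph) (black : pred (vertex G))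
    (hG : property_star black) :
  (forall M : {set edge G}, perfect_matching M ->
     tofrac (mrk black M) = ymon (ht black M)
     /\ forall f : bface G, 0 <= ht black M f)
  /\ tofrac (face_poly black)
     = \sum_(M : {set edge G} | perfect_matching M) ymon (ht black M).
Proof.
have main M : perfect_matching M ->
    tofrac (mrk black M) = ymon (ht black M) /\ forall f, 0 <= ht black M f.
  move=> pM; have /andP[pH /forallP/(_ M)/implyP/(_ pM) leM] := hat0P hG pM.
  have htE c : sat_chain black (hat0 black) c M ->
      forall f, ht black M f = (\sum_(s <- c) (s.1 == f))%N%:Z.
    move=> cM f; rewrite -(height_ht hG pM pH).
    rewrite (sat_chain_height hG (val f) pH cM).
    (* The chain starts at [hat0], whose height relative to itself is zero. *)
    rewrite [X in X + _](height_unique hG (h := fun=> 0) pH pH) ?add0r //.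
    by split=> // d; rewrite !subrr.
  have ymonE c : sat_chain black (hat0 black) c M ->
      ymon (ht black M) = tofrac (\prod_(s <- c) yvar s.1).
    move=> cM; rewrite rmorph_prod -(prod_expr_count (fun f => tofrac (yvar f))).
    by apply: eq_bigr => f _; rewrite (htE c cM).
  have [c cM] := sat_chain_exists hG leM.
  split; last by move=> f; rewrite (htE c cM).
  have [_ /(_ c cM) ->] : is_mrk black M (mrk black M).
    (* Products along two chains have the same image [ymon (ht black M)], and [tofrac] is injective,
       so the product is independent of the chain and [epsilon] is well specified. *)
    apply: epsilon_spec; exists (\prod_(s <- c) yvar s.1); split; first by exists c.
    move=> c' c'M; apply/eqP; rewrite -tofrac_eq.
    by rewrite -(ymonE _ cM) -(ymonE _ c'M).
  by rewrite -(ymonE _ cM).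
split=> //; rewrite /face_poly rmorph_sum.
by apply: eq_bigr => M /main[].
Qed.
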